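(* Let $\mathbf{B}$ be a cartesian bicategory in which every map is comonadic. Then every object of $\mathbf{B}$ is separable. (That is, for a cartesian bicategory, the axiom ''Maps are Comonadic'' implies the axiom ''Separable''.)
   Context: Bicategories are taken normal (identity constraints strict). A map in a bicategory $\mathbf{B}$ is an arrow $f$ having a right adjoint; a chosen right adjoint is written $f^*$, with unit $\eta_f:1\to f^*f$ and counit $\epsilon_f:ff^*\to 1$. $\mathrm{Map}\,\mathbf{B}$ is the locally full subbicategory of $\mathbf{B}$ with the same objects, the maps as arrows, and all 2-cells between them. Limits in bicategories are meant in the bicategorical sense. Cartesian bicategory: $\mathbf{B}$ is cartesian if (1) $\mathrm{Map}\,\mathbf{B}$ has finite products $\times$, $1$, with projections $p,r$; (2) each hom category $\mathbf{B}(X,A)$ has finite products, written $\wedge,\top$; (3) the following canonical lax functors $\otimes:\mathbf{B}\times\mathbf{B}\to\mathbf{B}$ and $I:\mathbf{1}\to\mathbf{B}$ are pseudofunctors (their constraints are invertible). On objects $X\otimes Y=X\times Y$; for arrows $R:X\to A$, $S:Y\to B$, $R\otimes S=(p_{A,B}^*\,R\,p_{X,Y})\wedge(r_{A,B}^*\,S\,r_{X,Y})$; the constraint $1_{X\otimes Y}\to 1_X\otimes 1_Y$ is induced by the units $\eta_p,\eta_r$, and $(R'\otimes S')(R\otimes S)\to (R'R)\otimes(S'S)$ is induced by the local projections and the counits $\epsilon_p,\epsilon_r$. $I$ picks the object $I=1$ with the arrow $\top_{I,I}$, with constraints the unique 2-cells $1_I\to\top_{I,I}$ and $\top_{I,I}\top_{I,I}\to\top_{I,I}$.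 An object $A$ is separable if, for the diagonal map $d_A:A\to A\otimes A$, the unit $\eta_{d_A}:1_A\to d_A^*d_A$ is invertible. An Eilenberg-Moore object for a comonad $(A,G,\epsilon,\delta)$ in $\mathbf{B}$ is an object $A_G$ with an arrow $g:A_G\to A$ and a counital, coassociative coaction $\gamma:g\to Gg$ such that for every $X$ composition with $(g,\gamma)$ is an equivalence from $\mathbf{B}(X,A_G)$ to the category of $G$-coalgebras with domain $X$. A map $g:X\to A$ is comonadic if $X$ with $g$ and $g\eta_g:g\to gg^*g$ is an Eilenberg-Moore object for the comonad $gg^*$ on $A$. *)

(* Defs.v *)
From Corelib Require Import ssreflect ssrfun ssrbool.
From Stdlib Require Import ProofIrrelevance.

Set Implicit Arguments.
Unset Strict Implicit.
Unset Printing Implicit Defensive.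

Declare Scope bicat_scope.
Open Scope bicat_scope.

Reserved Notation "b • a" (at level 45, right associativity).
Reserved Notation "g ⋅ f" (at level 40, left associativity).
Reserved Notation "g ◁ a" (at level 41, right associativity).
Reserved Notation "b ▷ f" (at level 41, right associativity).

Record category := Category {
  ob :> Type;
  mor : ob -> ob -> Type;
  idm : forall x, mor x x;
  cmp : forall x y z, mor y z -> mor x y -> mor x z;
  cmp1m : forall x y (a : mor x y), cmp (idm y) a = a;
  cmpm1 : forall x y (a : mor x y), cmp a (idm x) = a;
  cmpA : forall x y z t (c : mor z t) (b : mor y z) (a : mor x y),
    cmp c (cmp b a) = cmp (cmp c b) a }.

Arguments mor {_} _ _.
Arguments idm {_} _.
Arguments cmp {_ _ _ _} _ _.

Notation "b • a" := (cmp b a) : bicat_scope.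

Definition invertible (C : category) (x y : C) (a : mor x y) : Prop :=
  exists b : mor y x, b • a = idm x /\ a • b = idm y.

Record functor (C D : category) := Functor {
  fob :> C -> D;
  fmor : forall x y, mor x y -> mor (fob x) (fob y);
  fmor1 : forall x, fmor (idm x) = idm (fob x);
  fmorM : forall x y z (b : mor y z) (a : mor x y),
    fmor (b • a) = fmor b • fmor a }.

Definition functor_id (C : category) : functor C C :=
  @Functor C C (fun x => x) (fun x y a => a)
    (fun=> erefl) (fun _ _ _ _ _ => erefl).

Definition functor_comp (C D E : category) (G : functor D E) (F : functor C D) :
  functor C E.
Proof.
by apply: (@Functor C E (fun x => G (F x)) (fun x y a => fmor G (fmor F a)))
  => [x|x y z b a]; rewrite ?fmor1 // !fmorM.
Defined.

Record nat_iso (C D : category) (F G : functor C D) := NatIso {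
  nat_at :> forall x, mor (F x) (G x);
  nat_comm : forall x y (a : mor x y), fmor G a • nat_at x = nat_at y • fmor F a;
  nat_inv : forall x, invertible (nat_at x) }.

Record equivalence (C D : category) (F : functor C D) := Equivalence {
  eqv_inv : functor D C;
  eqv_unit : nat_iso (functor_id C) (functor_comp eqv_inv F);
  eqv_counit : nat_iso (functor_comp F eqv_inv) (functor_id D) }.

Definition unit_cat : category :=
  @Category unit (fun _ _ => unit) (fun=> tt) (fun _ _ _ _ _ => tt)
    (fun _ _ a => match a with tt => erefl end)
    (fun _ _ a => match a with tt => erefl end)
    (fun _ _ _ _ _ _ _ => erefl).

Definition functor_to_unit (C : category) : functor C unit_cat :=
  @Functor C unit_cat (fun=> tt) (fun _ _ _ => tt)
    (fun=> erefl) (fun _ _ _ _ _ => erefl).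

Definition prod_cat (C D : category) : category.
Proof.
apply: (@Category (C * D) (fun u v => (mor u.1 v.1 * mor u.2 v.2)%type)
  (fun u => (idm u.1, idm u.2))
  (fun u v w b a => (b.1 • a.1, b.2 • a.2))).
- by move=> x y [a b]; rewrite /= !cmp1m.
- by move=> x y [a b]; rewrite /= !cmpm1.
- by move=> x y z t c b a; rewrite /= !cmpA.
Defined.

Definition functor_pair (C D E : category) (F : functor C D) (G : functor C E) :
  functor C (prod_cat D E).
Proof.
by apply: (@Functor C (prod_cat D E)
  (fun x => (F x, G x)) (fun x y a => (fmor F a, fmor G a)))
  => [x|x y z b a]; rewrite ?fmor1 ?fmorM.
Defined.

Definition full_subcat (C : category) (P : C -> Prop) : category :=
  @Category {x : C | P x} (fun x y => mor (proj1_sig x) (proj1_sig y))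
    (fun x => idm (proj1_sig x)) (fun _ _ _ b a => b • a)
    (fun _ _ a => cmp1m a) (fun _ _ a => cmpm1 a)
    (fun _ _ _ _ c b a => cmpA c b a).

Record cat_products (C : category) := CatProducts {
  meet : C -> C -> C;
  mfst : forall x y, mor (meet x y) x;
  msnd : forall x y, mor (meet x y) y;
  mpair : forall z x y, mor z x -> mor z y -> mor z (meet x y);
  mfst_pair : forall z x y (a : mor z x) (b : mor z y),
    mfst x y • mpair a b = a;
  msnd_pair : forall z x y (a : mor z x) (b : mor z y),
    msnd x y • mpair a b = b;
  mpair_uniq : forall z x y (c : mor z (meet x y)),
    mpair (mfst x y • c) (msnd x y • c) = c;
  top : C;
  bang : forall z, mor z top;
  bang_uniq : forall z (c : mor z top), c = bang z }.

(* Arrows are composed in applicative order.  Horizontal composition of 2-cells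
   is presented by the two whiskerings and the interchange law. *)
Record bicategory := Bicategory {
  obj :> Type;
  hom : obj -> obj -> category;
  id1 : forall X, hom X X;
  cmp1 : forall X Y Z, hom Y Z -> hom X Y -> hom X Z;
  lwhisk : forall X Y Z (g : hom Y Z) (f f' : hom X Y),
    mor f f' -> mor (cmp1 g f) (cmp1 g f');
  rwhisk : forall X Y Z (g g' : hom Y Z) (b : mor g g') (f : hom X Y),
    mor (cmp1 g f) (cmp1 g' f);
  lun : forall X Y (f : hom X Y), mor (cmp1 (id1 Y) f) f;
  lunI : forall X Y (f : hom X Y), mor f (cmp1 (id1 Y) f);
  run : forall X Y (f : hom X Y), mor (cmp1 f (id1 X)) f;
  runI : forall X Y (f : hom X Y), mor f (cmp1 f (id1 X));
  assoc : forall X Y Z W (h : hom Z W) (g : hom Y Z) (f : hom X Y),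
    mor (cmp1 (cmp1 h g) f) (cmp1 h (cmp1 g f));
  assocI : forall X Y Z W (h : hom Z W) (g : hom Y Z) (f : hom X Y),
    mor (cmp1 h (cmp1 g f)) (cmp1 (cmp1 h g) f);
  lunK : forall X Y (f : hom X Y), lunI f • lun f = idm _;
  lunIK : forall X Y (f : hom X Y), lun f • lunI f = idm _;
  runK : forall X Y (f : hom X Y), runI f • run f = idm _;
  runIK : forall X Y (f : hom X Y), run f • runI f = idm _;
  assocK : forall X Y Z W (h : hom Z W) (g : hom Y Z) (f : hom X Y),
    assocI h g f • assoc h g f = idm _;
  assocIK : forall X Y Z W (h : hom Z W) (g : hom Y Z) (f : hom X Y),
    assoc h g f • assocI h g f = idm _;
  lwhisk1 : forall X Y Z (g : hom Y Z) (f : hom X Y),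
    lwhisk g (idm f) = idm (cmp1 g f);
  rwhisk1 : forall X Y Z (g : hom Y Z) (f : hom X Y),
    rwhisk (idm g) f = idm (cmp1 g f);
  lwhiskM : forall X Y Z (g : hom Y Z) (f f' f'' : hom X Y)
    (b : mor f' f'') (a : mor f f'),
    lwhisk g (b • a) = lwhisk g b • lwhisk g a;
  rwhiskM : forall X Y Z (g g' g'' : hom Y Z)
    (b : mor g' g'') (a : mor g g') (f : hom X Y),
    rwhisk (b • a) f = rwhisk b f • rwhisk a f;
  interchange : forall X Y Z (g g' : hom Y Z) (f f' : hom X Y)
    (b : mor g g') (a : mor f f'),
    rwhisk b f' • lwhisk g a = lwhisk g' a • rwhisk b f;
  lun_nat : forall X Y (f f' : hom X Y) (a : mor f f'),
    lun f' • lwhisk (id1 Y) a = a • lun f;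
  run_nat : forall X Y (f f' : hom X Y) (a : mor f f'),
    run f' • rwhisk a (id1 X) = a • run f;
  assoc_natr : forall X Y Z W (h : hom Z W) (g : hom Y Z) (f f' : hom X Y)
    (a : mor f f'),
    assoc h g f' • lwhisk (cmp1 h g) a = lwhisk h (lwhisk g a) • assoc h g f;
  assoc_natm : forall X Y Z W (h : hom Z W) (g g' : hom Y Z) (f : hom X Y)
    (a : mor g g'),
    assoc h g' f • rwhisk (lwhisk h a) f = lwhisk h (rwhisk a f) • assoc h g f;
  assoc_natl : forall X Y Z W (h h' : hom Z W) (g : hom Y Z) (f : hom X Y)
    (a : mor h h'),
    assoc h' g f • rwhisk (rwhisk a g) f = rwhisk a (cmp1 g f) • assoc h g f;
  triangle : forall X Y Z (g : hom Y Z) (f : hom X Y),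
    lwhisk g (lun f) • assoc g (id1 Y) f = rwhisk (run g) f;
  pentagon : forall X Y Z W V
    (k : hom W V) (h : hom Z W) (g : hom Y Z) (f : hom X Y),
    lwhisk k (assoc h g f) • assoc k (cmp1 h g) f • rwhisk (assoc k h g) f
    = assoc k h (cmp1 g f) • assoc (cmp1 k h) g f }.

Arguments hom {_} _ _.
Arguments id1 {_} _.
Arguments cmp1 {_ _ _ _} _ _.
Arguments lwhisk {_ _ _ _} _ {_ _} _.
Arguments rwhisk {_ _ _ _ _ _} _ _.
Arguments lun {_ _ _} _.
Arguments lunI {_ _ _} _.
Arguments run {_ _ _} _.
Arguments runI {_ _ _} _.
Arguments assoc {_ _ _ _ _} _ _ _.
Arguments assocI {_ _ _ _ _} _ _ _.

Notation "g ⋅ f" := (cmp1 g f) : bicat_scope.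
Notation "g ◁ a" := (lwhisk g a) : bicat_scope.
Notation "b ▷ f" := (rwhisk b f) : bicat_scope.

Definition cell_of_eq (C : category) (x y : C) (e : x = y) : mor x y :=
  match e in _ = z return mor x z with erefl => idm x end.

(* The identity constraints are identities, up to the equalities of their
   endpoints. *)
Definition normal (B : bicategory) : Prop :=
  (forall (X Y : B) (f : hom X Y),
     exists e : id1 Y ⋅ f = f, lun f = cell_of_eq e) /\
  (forall (X Y : B) (f : hom X Y),
     exists e : f ⋅ id1 X = f, run f = cell_of_eq e).

Definition hcomp (B : bicategory) (X Y Z : B) (g g' : hom Y Z) (f f' : hom X Y)
    (b : mor g g') (a : mor f f') : mor (g ⋅ f) (g' ⋅ f') :=
  (g' ◁ a) • (b ▷ f).

Definition postcomp (B : bicategory) (X Y Z : B) (g : hom Y Z) :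
  functor (hom X Y) (hom X Z) :=
  @Functor (hom X Y) (hom X Z) (fun f => g ⋅ f) (fun _ _ a => g ◁ a)
    (fun f => lwhisk1 g f) (fun _ _ _ b a => lwhiskM g b a).

Definition locally_full_sub (B : bicategory)
    (P : forall X Y : B, hom X Y -> Prop)
    (P1 : forall X, P X X (id1 X))
    (PM : forall X Y Z (g : hom Y Z) (f : hom X Y),
       P Y Z g -> P X Y f -> P X Z (g ⋅ f)) : bicategory.
Proof.
pose s X Y (f : {f : hom X Y | P X Y f}) := proj1_sig f.
refine (@Bicategory B (fun X Y => full_subcat (P X Y))
  (fun X => exist _ (id1 X) (P1 X))
  (fun X Y Z g f => exist _ (s _ _ g ⋅ s _ _ f) (PM _ _ _ _ _ (proj2_sig g) (proj2_sig f)))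
  (fun X Y Z g f f' a => s _ _ g ◁ a)
  (fun X Y Z g g' b f => b ▷ s _ _ f)
  (fun X Y f => lun (s _ _ f)) (fun X Y f => lunI (s _ _ f))
  (fun X Y f => run (s _ _ f)) (fun X Y f => runI (s _ _ f))
  (fun X Y Z W h g f => assoc (s _ _ h) (s _ _ g) (s _ _ f))
  (fun X Y Z W h g f => assocI (s _ _ h) (s _ _ g) (s _ _ f))
  _ _ _ _ _ _ _ _ _ _ _ _ _ _ _ _ _ _) => *.
- exact: lunK.
- exact: lunIK.
- exact: runK.
- exact: runIK.
- exact: assocK.
- exact: assocIK.
- exact: lwhisk1.
- exact: rwhisk1.
- exact: lwhiskM.
- exact: rwhiskM.
- exact: interchange.
- exact: lun_nat.
- exact: run_nat.
- exact: assoc_natr.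
- exact: assoc_natm.
- exact: assoc_natl.
- exact: triangle.
- exact: pentagon.
Defined.

(* Bicategorical products: the universal properties are equivalences of
   hom-categories. *)
Record finite_products (B : bicategory) := FiniteProducts {
  pobj : B -> B -> B;
  prj1 : forall X Y, hom (pobj X Y) X;
  prj2 : forall X Y, hom (pobj X Y) Y;
  pobj_eqv : forall Z X Y,
    equivalence (functor_pair (@postcomp B Z _ _ (prj1 X Y))
                              (@postcomp B Z _ _ (prj2 X Y)));
  tobj : B;
  tobj_eqv : forall Z, equivalence (functor_to_unit (hom Z tobj)) }.

Definition pdiag (B : bicategory) (P : finite_products B) (A : B) :
  hom A (pobj P A A) :=
  eqv_inv (pobj_eqv P A A A) (id1 A, id1 A).


Section Coherence.

Variable B : bicategory.
Implicit Types X Y Z W V : B.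

Lemma cancell X Y (x y z : hom X Y) (i : mor y z) (j : mor z y) (a b : mor x y) :
  j • i = idm y -> i • a = i • b -> a = b.
Proof. by move=> ji ab; rewrite -[a]cmp1m -[b]cmp1m -ji -!cmpA ab. Qed.

Lemma cancelr X Y (x y z : hom X Y) (i : mor x y) (j : mor y x) (a b : mor y z) :
  i • j = idm y -> a • i = b • i -> a = b.
Proof. by move=> ij ab; rewrite -[a]cmpm1 -[b]cmpm1 -ij !cmpA ab. Qed.

Lemma cmpKl X Y (x y z : hom X Y) (i : mor y z) (j : mor z y) (a : mor x y) :
  j • i = idm y -> j • i • a = a.
Proof. by move=> ji; rewrite cmpA ji cmp1m. Qed.

Lemma rwhisk_inj X Y (f g : hom X Y) (a b : mor f g) :
  a ▷ id1 X = b ▷ id1 X -> a = b.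
Proof.
move=> ab; apply: (cancelr (runIK f)).
by rewrite -!run_nat ab.
Qed.

Lemma lwhisk_inj X Y (f g : hom X Y) (a b : mor f g) :
  id1 Y ◁ a = id1 Y ◁ b -> a = b.
Proof.
move=> ab; apply: (cancelr (lunIK f)).
by rewrite -!lun_nat ab.
Qed.

Lemma lwhiskK X Y Z (h : hom Y Z) (x y : hom X Y) (i : mor x y) (j : mor y x) :
  j • i = idm x -> (h ◁ j) • (h ◁ i) = idm _.
Proof. by move=> ji; rewrite -lwhiskM ji lwhisk1. Qed.

Lemma rwhiskK X Y Z (x y : hom Y Z) (h : hom X Y) (i : mor x y) (j : mor y x) :
  j • i = idm x -> (j ▷ h) • (i ▷ h) = idm _.
Proof. by move=> ji; rewrite -rwhiskM ji rwhisk1. Qed.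

Lemma rwhisk_lun X Y Z (g : hom Y Z) (f : hom X Y) :
  lun g ▷ f = lun (g ⋅ f) • assoc (id1 Z) g f.
Proof.
apply: lwhisk_inj.
apply: (cancelr (assocIK _ _ _)).
apply: (cancelr (rwhiskK f (assocIK (id1 Z) (id1 Z) g))).
rewrite lwhiskM -!cmpA pentagon [RHS]cmpA triangle -assoc_natl -triangle.
by rewrite rwhiskM !cmpA assoc_natm.
Qed.

Lemma lwhisk_run X Y Z (g : hom Y Z) (f : hom X Y) :
  run (g ⋅ f) = (g ◁ run f) • assoc g f (id1 X).
Proof.
apply: rwhisk_inj.
apply: (cancell (assocK _ _ _)).
rewrite rwhiskM [RHS]cmpA assoc_natm -!triangle lwhiskM -!cmpA pentagon.
by rewrite cmpA assoc_natr -cmpA.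
Qed.

Lemma lwhisk_runI X Y Z (g : hom Y Z) (f : hom X Y) :
  runI (g ⋅ f) = assocI g f (id1 X) • (g ◁ runI f).
Proof.
apply: (cancelr (runIK (g ⋅ f))); rewrite runK lwhisk_run -!cmpA.
by rewrite (cmpA (g ◁ runI f)) lwhiskK ?runK // cmp1m assocK.
Qed.

Lemma lun_run X : lun (id1 X) = run (id1 X).
Proof.
apply: rwhisk_inj; rewrite rwhisk_lun -triangle; congr (_ • _).
by apply: (cancell (lunK _)); rewrite lun_nat.
Qed.

Lemma rwhisk_lwhisk X Y Z W (g : hom Z W) (f f' : hom Y Z) (a : mor f f')
    (w : hom X Y) :
  (g ◁ a) ▷ w = assocI g f' w • (g ◁ (a ▷ w)) • assoc g f w.
Proof. by rewrite -assoc_natm cmpKl // assocK. Qed.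

Lemma rwhisk_rwhisk X Y Z W (g g' : hom Z W) (a : mor g g') (f : hom Y Z)
    (w : hom X Y) :
  (a ▷ f) ▷ w = assocI g' f w • (a ▷ (f ⋅ w)) • assoc g f w.
Proof. by rewrite -assoc_natl cmpKl // assocK. Qed.

Lemma lwhisk_cmp X Y Z W (h : hom Z W) (g : hom Y Z) (f f' : hom X Y)
    (a : mor f f') :
  (h ⋅ g) ◁ a = assocI h g f' • (h ◁ (g ◁ a)) • assoc h g f.
Proof. by rewrite -assoc_natr cmpKl // assocK. Qed.

Lemma lwhisk_id X Y (f f' : hom X Y) (a : mor f f') :
  id1 Y ◁ a = lunI f' • a • lun f.
Proof. by rewrite -lun_nat cmpKl // lunK. Qed.

Lemma rwhisk_assoc X Y Z W V (k : hom W V) (h : hom Z W) (g : hom Y Z)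
    (w : hom X Y) :
  assoc k h g ▷ w = assocI k (h ⋅ g) w • (k ◁ assocI h g w)
                    • assoc k h (g ⋅ w) • assoc (k ⋅ h) g w.
Proof.
rewrite -pentagon (cmpA (k ◁ assocI _ _ _)) lwhiskK ?cmp1m ?assocK //.
by rewrite cmpKl // assocK.
Qed.

Lemma rwhisk_assocI X Y Z W V (k : hom W V) (h : hom Z W) (g : hom Y Z)
    (w : hom X Y) :
  assocI k h g ▷ w = assocI (k ⋅ h) g w • assocI k h (g ⋅ w)
                    • (k ◁ assoc h g w) • assoc k (h ⋅ g) w.
Proof.
apply: (cancelr (rwhiskK w (assocIK k h g))).
rewrite rwhiskK ?assocK // -!cmpA pentagon.
by rewrite (cmpKl _ (assocK _ _ _)) assocK.
Qed.

Lemma rwhisk_lunI X Y Z (g : hom Y Z) (f : hom X Y) :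
  lunI g ▷ f = assocI (id1 Z) g f • lunI (g ⋅ f).
Proof.
apply: (cancelr (rwhiskK f (lunIK g))).
rewrite rwhiskK ?lunK // rwhisk_lun -!cmpA.
by rewrite (cmpKl _ (lunK _)) assocK.
Qed.

Lemma rwhisk_run X Y Z (g : hom Y Z) (f : hom X Y) :
  run g ▷ f = (g ◁ lun f) • assoc g (id1 Y) f.
Proof. by rewrite triangle. Qed.

Lemma rwhisk_runI X Y Z (g : hom Y Z) (f : hom X Y) :
  runI g ▷ f = assocI g (id1 Y) f • (g ◁ lunI f).
Proof.
apply: (cancelr (rwhiskK f (runIK g))).
rewrite rwhiskK ?runK // rwhisk_run -!cmpA (cmpA (lwhisk _ _)).
by rewrite lwhiskK ?lunK // cmp1m assocK.
Qed.

End Coherence.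

Definition strictE := (rwhiskM, lwhiskM, rwhisk1, lwhisk1, rwhisk_lwhisk,
  rwhisk_rwhisk, lwhisk_cmp, lwhisk_id, rwhisk_assoc, rwhisk_assocI, rwhisk_lun,
  rwhisk_lunI, rwhisk_run, rwhisk_runI).

(* Cancellation of adjacent constraints inside a right-nested composite, under
   at most two left whiskerings. *)
Section Cancellation.

Variable B : bicategory.
Implicit Types X Y Z W V : B.

Definition cancels X Y (x y : hom X Y) (i : mor x y) (j : mor y x) :=
  ((j • i = idm x) * (forall z (a : mor z x), j • i • a = a)
   * (forall Z (k : hom Y Z), (k ◁ j) • (k ◁ i) = idm _)
   * (forall Z (k : hom Y Z) z (a : mor z (k ⋅ x)),
        (k ◁ j) • (k ◁ i) • a = a)
   * (forall Z W (h : hom Z W) (k : hom Y Z),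
        (h ◁ k ◁ j) • (h ◁ k ◁ i) = idm _)
   * (forall Z W (h : hom Z W) (k : hom Y Z) z (a : mor z (h ⋅ (k ⋅ x))),
        (h ◁ k ◁ j) • (h ◁ k ◁ i) • a = a))%type.

Lemma cancelsP X Y (x y : hom X Y) (i : mor x y) (j : mor y x) :
  j • i = idm x -> cancels i j.
Proof.
move=> ji; do !split=> // *; try by rewrite ?lwhiskK.
- exact: cmpKl.
- by rewrite cmpKl // lwhiskK.
- by rewrite cmpKl // !lwhiskK.
Qed.

Definition constraintsK X Y Z W (h : hom Z W) (g : hom Y Z) (f : hom X Y) :=
  (cancelsP (assocK h g f), cancelsP (assocIK h g f)).

Definition unitorsK X Y (f : hom X Y) :=
  (cancelsP (lunK f), cancelsP (lunIK f), cancelsP (runK f), cancelsP (runIK f)).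

End Cancellation.

(* Rewrites both sides of an equation between composites of whiskered 2-cells so
   that only 2-cells whiskered on the left along right-nested arrows remain, and
   cancels the constraints. *)
Ltac strict :=
  rewrite ?strictE -?cmpA;
  rewrite ?(constraintsK, unitorsK, cmp1m, cmpm1).

Section Adjunctions.

Variable B : bicategory.
Implicit Types X Y Z W : B.

Section Whiskered.

Variables (X A : B) (f : hom X A) (u : hom A X).

Definition unit_at (eta : mor (id1 X) (u ⋅ f)) W (w : hom W X) :
  mor w (u ⋅ (f ⋅ w)) := assoc u f w • (eta ▷ w) • lunI w.

Definition counit_at (eps : mor (f ⋅ u) (id1 A)) W (w : hom W A) :
  mor (f ⋅ (u ⋅ w)) w := lun w • (eps ▷ w) • assocI f u w.

End Whiskered.

(* zig is the triangle identity f ~ f1 -> f(uf) ~ (fu)f -> 1f ~ f, and zag is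
   u ~ 1u -> (uf)u ~ u(fu) -> u1 ~ u, with the unitors moved to the right-hand
   side. *)
Record right_adjoint X A (f : hom X A) := RightAdjoint {
  star : hom A X;
  eta : mor (id1 X) (star ⋅ f);
  eps : mor (f ⋅ star) (id1 A);
  zig : counit_at eps f • (f ◁ eta) = run f;
  zag : (star ◁ eps) • unit_at eta star = runI star }.

Lemma unitE X A (f : hom X A) (u : hom A X) (eta : mor (id1 X) (u ⋅ f))
    W (w : hom W X) :
  eta ▷ w = assocI u f w • unit_at eta w • lun w.
Proof. by rewrite /unit_at; strict. Qed.

Lemma counitE X A (f : hom X A) (u : hom A X) (eps : mor (f ⋅ u) (id1 A))
    W (w : hom W A) :
  eps ▷ w = lunI w • counit_at eps w • assoc f u w.
Proof. by rewrite /counit_at; strict. Qed.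

Lemma unit_at_nat X A (f : hom X A) (u : hom A X) (eta : mor (id1 X) (u ⋅ f))
    W (w w' : hom W X) (a : mor w w') :
  unit_at eta w' • a = (u ◁ f ◁ a) • unit_at eta w.
Proof.
rewrite /unit_at -!cmpA.
have -> : lunI w' • a = (id1 X ◁ a) • lunI w by strict.
by rewrite (cmpA (eta ▷ w')) interchange -cmpA cmpA assoc_natr -cmpA.
Qed.

Lemma counit_at_nat X A (f : hom X A) (u : hom A X) (eps : mor (f ⋅ u) (id1 A))
    W (w w' : hom W A) (a : mor w w') :
  counit_at eps w' • (f ◁ u ◁ a) = a • counit_at eps w.
Proof.
rewrite /counit_at -!cmpA.
have -> : assocI f u w' • (f ◁ u ◁ a) = ((f ⋅ u) ◁ a) • assocI f u w by strict.
by rewrite (cmpA (eps ▷ w')) interchange -cmpA cmpA lun_nat -cmpA.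
Qed.

Lemma unit_at_id X A (f : hom X A) (u : hom A X) (eta : mor (id1 X) (u ⋅ f)) :
  unit_at eta (id1 X) = (u ◁ runI f) • eta.
Proof.
apply: (cancelr (lunIK _)); rewrite /unit_at -!cmpA lunK cmpm1 lun_run -run_nat.
by rewrite lwhisk_run; strict.
Qed.

Lemma unit_at_whisk X A (f : hom X A) (u : hom A X) (eta : mor (id1 X) (u ⋅ f))
    W (w : hom W X) V (v : hom V W) :
  unit_at eta w ▷ v = 
   assocI u (f ⋅ w) v • (u ◁ assocI f w v) • unit_at eta (w ⋅ v).
Proof. by rewrite /unit_at; strict. Qed.

Lemma counit_at_whisk X A (f : hom X A) (u : hom A X) (eps : mor (f ⋅ u) (id1 A))
    W (w : hom W A) V (v : hom V W) :
  counit_at eps w ▷ v = 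
   counit_at eps (w ⋅ v) • (f ◁ assoc u w v) • assoc f (u ⋅ w) v.
Proof. by rewrite /counit_at; strict. Qed.

Section Zigzag.

Variables (X A : B) (f : hom X A) (a : right_adjoint f).

Lemma zig_at W (w : hom W X) :
  counit_at (eps a) (f ⋅ w) • (f ◁ unit_at (eta a) w) = idm _.
Proof.
have := congr1 (fun c => (c ▷ w) • assocI f (id1 X) w • (f ◁ lunI w)) (zig a).
rewrite rwhiskM counit_at_whisk rwhisk_run rwhisk_lwhisk.
by rewrite /unit_at; strict.
Qed.

Lemma zag_at W (w : hom W A) :
  (star a ◁ counit_at (eps a) w) • unit_at (eta a) (star a ⋅ w) = idm _.
Proof.
have := congr1 (fun c => (star a ◁ lun w) • assoc (star a) (id1 A) w • (c ▷ w))
  (zag a).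
rewrite rwhiskM unit_at_whisk rwhisk_runI rwhisk_lwhisk.
by rewrite /counit_at; strict.
Qed.

End Zigzag.

Lemma right_adjoint_id X : right_adjoint (id1 X).
Proof.
apply: (@RightAdjoint X X (id1 X) (id1 X) (lunI (id1 X)) (lun (id1 X))).
- by rewrite /counit_at; strict; rewrite lun_run.
- rewrite /unit_at; strict.
  by apply: (cancelr (lunIK _)); rewrite lunK lun_run runK.
Qed.

Section Composite.

Variables (X Y Z : B) (g : hom Y Z) (f : hom X Y).
Variables (b : right_adjoint g) (a : right_adjoint f).

Let ETA : mor (id1 X) ((star a ⋅ star b) ⋅ (g ⋅ f)) :=
  assocI (star a) (star b) (g ⋅ f) • (star a ◁ unit_at (eta b) f) • eta a.

Let EPS : mor ((g ⋅ f) ⋅ (star a ⋅ star b)) (id1 Z) :=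
  eps b • (g ◁ counit_at (eps a) (star b)) • assoc g f (star a ⋅ star b).

Lemma counit_at_cmp W (w : hom W Z) :
  counit_at EPS w = counit_at (eps b) w • (g ◁ counit_at (eps a) (star b ⋅ w))
    • (g ◁ f ◁ assoc (star a) (star b) w) • assoc g f ((star a ⋅ star b) ⋅ w).
Proof. by rewrite /EPS /counit_at; strict. Qed.

Lemma unit_at_cmp W (w : hom W X) :
  unit_at ETA w = assocI (star a) (star b) ((g ⋅ f) ⋅ w)
    • (star a ◁ star b ◁ assocI g f w)
    • (star a ◁ unit_at (eta b) (f ⋅ w)) • unit_at (eta a) w.
Proof. by rewrite /ETA /unit_at; strict. Qed.

Lemma right_adjoint_cmp : right_adjoint (g ⋅ f).
Proof.
apply: (@RightAdjoint X Z (g ⋅ f) (star a ⋅ star b) ETA EPS).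
- rewrite counit_at_cmp /ETA lwhisk_run -(zig a).
  have := counit_at_nat (eps a) (unit_at (eta b) f); have := zig_at b f.
  move: (unit_at (eta b) f) (counit_at (eps b) _) (counit_at (eps a) _)
    (counit_at (eps a) _) => u c c' c'' cu cN.
  by strict; rewrite (cmpA (g ◁ c'')) -lwhiskM cN lwhiskM -cmpA cmpA cu cmp1m.
- rewrite unit_at_cmp /EPS lwhisk_runI -(zag b).
  have := unit_at_nat (eta b) (counit_at (eps a) (star b)); have := zag_at a (star b).
  move: (counit_at (eps a) (star b)) (unit_at (eta b) _) (unit_at (eta b) _)
    (unit_at (eta a) _) => c u u' u'' cu uN.
  strict; do 2!congr (_ • _).
  by rewrite (cmpA (star a ◁ star b ◁ g ◁ c)) -lwhiskM -uN lwhiskM -cmpA cu cmpm1.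
Qed.

End Composite.

Definition is_map X A (f : hom X A) : Prop := inhabited (right_adjoint f).

Lemma is_map_id X : is_map (id1 X).
Proof. exact: inhabits (right_adjoint_id X). Qed.

Lemma is_map_cmp X Y Z (g : hom Y Z) (f : hom X Y) :
  is_map g -> is_map f -> is_map (g ⋅ f).
Proof. by case=> b [a]; exact: inhabits (right_adjoint_cmp b a). Qed.

End Adjunctions.

Definition Map (B : bicategory) : bicategory :=
  locally_full_sub (@is_map_id B) (@is_map_cmp B).

Section Comonads.

Variable B : bicategory.
Implicit Types X A : B.

Record comonad A := Comonad {
  cfun :> hom A A;
  ceps : mor cfun (id1 A);
  cdelta : mor cfun (cfun ⋅ cfun);
  ceps_l : lun cfun • (ceps ▷ cfun) • cdelta = idm cfun;
  ceps_r : run cfun • (cfun ◁ ceps) • cdelta = idm cfun;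
  cdeltaA : assoc cfun cfun cfun • (cdelta ▷ cfun) • cdelta
            = (cfun ◁ cdelta) • cdelta }.

Record coalgebra A (G : comonad A) X := Coalgebra {
  carrier :> hom X A;
  coact : mor carrier (G ⋅ carrier);
  coact_eps : lun carrier • (ceps G ▷ carrier) • coact = idm carrier;
  coact_delta : assoc G G carrier • (cdelta G ▷ carrier) • coact
                = (G ◁ coact) • coact }.

Section CoalgebraCategory.

Variables (A : B) (G : comonad A) (X : B).

Definition coalg_mor (h k : coalgebra G X) :=
  {a : mor h k | coact k • a = (G ◁ a) • coact h}.

Lemma coalg_mor_eq (h k : coalgebra G X) (a b : coalg_mor h k) :
  proj1_sig a = proj1_sig b -> a = b.
Proof.
case: a b => [a aP] [b bP] /= ab; case: _ / ab bP => bP.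
by rewrite (proof_irrelevance _ aP bP).
Qed.

Lemma coalg_idP (h : coalgebra G X) : coact h • idm h = (G ◁ idm h) • coact h.
Proof. by rewrite lwhisk1 cmpm1 cmp1m. Qed.

Lemma coalg_cmpP (h k l : coalgebra G X) (b : coalg_mor k l) (a : coalg_mor h k) :
  coact l • proj1_sig b • proj1_sig a
  = (G ◁ (proj1_sig b • proj1_sig a)) • coact h.
Proof.
by rewrite cmpA (proj2_sig b) -cmpA (proj2_sig a) cmpA lwhiskM.
Qed.

Definition coalg_cat : category.
Proof.
apply: (@Category (coalgebra G X) coalg_mor
  (fun h => exist _ (idm h) (coalg_idP h))
  (fun h k l b a => exist _ (proj1_sig b • proj1_sig a) (coalg_cmpP b a))).
- by move=> h k a; apply: coalg_mor_eq; rewrite /= cmp1m.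
- by move=> h k a; apply: coalg_mor_eq; rewrite /= cmpm1.
- by move=> h k l m c b a; apply: coalg_mor_eq; rewrite /= cmpA.
Defined.

End CoalgebraCategory.

Section Comparison.

Variables (A : B) (G : comonad A) (AG : B) (g : coalgebra G AG) (X : B).

Definition comparison_coact (k : hom X AG) : mor (g ⋅ k) (G ⋅ (g ⋅ k)) :=
  assoc G g k • (coact g ▷ k).

Lemma comparison_eps (k : hom X AG) :
  lun (g ⋅ k) • (ceps G ▷ (g ⋅ k)) • comparison_coact k = idm (g ⋅ k).
Proof.
have := congr1 (fun c => c ▷ k) (coact_eps g).
by rewrite /comparison_coact; strict.
Qed.

Lemma comparison_delta (k : hom X AG) :
  assoc G G (g ⋅ k) • (cdelta G ▷ (g ⋅ k)) • comparison_coact k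
  = (G ◁ comparison_coact k) • comparison_coact k.
Proof.
have := congr1 (fun c => (G ◁ assoc G g k) • assoc G (G ⋅ g) k • (c ▷ k))
  (coact_delta g).
by rewrite /comparison_coact; strict.
Qed.

Definition comparison_ob (k : hom X AG) : coalgebra G X :=
  Coalgebra (comparison_eps k) (comparison_delta k).

Lemma comparison_morP (k l : hom X AG) (a : mor k l) :
  comparison_coact l • (g ◁ a) = (G ◁ g ◁ a) • comparison_coact k.
Proof.
by rewrite /comparison_coact -cmpA interchange cmpA assoc_natr -cmpA.
Qed.

Definition comparison : functor (hom X AG) (coalg_cat G X).
Proof.
apply: (@Functor (hom X AG) (coalg_cat G X) comparison_ob
  (fun k l a => exist _ (g ◁ a) (comparison_morP a))) => *.
- by apply: coalg_mor_eq; rewrite /= lwhisk1.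
- by apply: coalg_mor_eq; rewrite /= lwhiskM.
Defined.

End Comparison.

Definition is_em_object A (G : comonad A) AG (g : coalgebra G AG) : Prop :=
  forall X, inhabited (equivalence (comparison g X)).

Section AdjunctionComonad.

Variables (X A : B) (g : hom X A) (a : right_adjoint g).

Let G := g ⋅ star a.

(* g u -> g (u (g u)) ~ (g u)(g u), by the unit, where u is the right adjoint *)
Definition adj_delta : mor G (G ⋅ G) :=
  assocI g (star a) G • (g ◁ unit_at (eta a) (star a)).

Lemma adj_eps_l : lun G • (eps a ▷ G) • adj_delta = idm G.
Proof.
by have := zig_at a (star a); rewrite /adj_delta /counit_at -!cmpA.
Qed.

Lemma adj_eps_r : run G • (G ◁ eps a) • adj_delta = idm G.
Proof.
rewrite /adj_delta lwhisk_run; move: (zag a).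
move: (unit_at (eta a) (star a)) => u uz.
by strict; rewrite -lwhiskM uz -lwhiskM runIK lwhisk1.
Qed.

Lemma adj_deltaA :
  assoc G G G • (adj_delta ▷ G) • adj_delta = (G ◁ adj_delta) • adj_delta.
Proof.
have := congr1 (lwhisk g) (unit_at_nat (eta a) (unit_at (eta a) (star a))).
by rewrite /adj_delta /unit_at; strict => ->.
Qed.

Definition adj_comonad : comonad A := Comonad adj_eps_l adj_eps_r adj_deltaA.

Definition adj_coact : mor g (G ⋅ g) :=
  assocI g (star a) g • (g ◁ eta a) • runI g.

Lemma adj_coact_eps : lun g • (eps a ▷ g) • adj_coact = idm g.
Proof.
have := congr1 (fun c => c • runI g) (zig a).
by rewrite /adj_coact /counit_at runIK; strict.
Qed.

Lemma adj_coact_delta :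
  assoc G G g • (adj_delta ▷ g) • adj_coact = (G ◁ adj_coact) • adj_coact.
Proof.
have := congr1 (fun c => (g ◁ c) • runI g) (unit_at_nat (eta a) (eta a)).
by rewrite unit_at_id /adj_coact /adj_delta /unit_at; strict => ->.
Qed.

Definition adj_coalgebra : coalgebra adj_comonad X :=
  @Coalgebra A adj_comonad X g adj_coact adj_coact_eps adj_coact_delta.

Definition comonadic : Prop := is_em_object adj_coalgebra.

End AdjunctionComonad.

End Comonads.

(* A choice of f^* for every map f. *)
Definition adjoint_choice (B : bicategory) : Type :=
  forall (X A : B) (f : hom X A), is_map f -> right_adjoint f.

Section Cartesian.

Variables (B : bicategory) (adj : adjoint_choice B).

Definition arrow (X A : B) (f : @hom (Map B) X A) : hom X A := proj1_sig f.

Definition radj (X A : B) (f : @hom (Map B) X A) : right_adjoint (arrow f) :=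
  adj (proj2_sig f).

Section Tensor.

Variables (P : finite_products (Map B)).
Variables (L : forall X A : B, cat_products (hom X A)).

Let p (X Y : B) : hom (pobj P X Y : B) X := arrow (prj1 P X Y).
Let r (X Y : B) : hom (pobj P X Y : B) Y := arrow (prj2 P X Y).
Let p_adj (X Y : B) : right_adjoint (p X Y) := radj (prj1 P X Y).
Let r_adj (X Y : B) : right_adjoint (r X Y) := radj (prj2 P X Y).

Definition tensor (X Y A D : B) (R : hom X A) (S : hom Y D) :
    hom (pobj P X Y : B) (pobj P A D : B) :=
  meet (L _ _) (star (p_adj A D) ⋅ (R ⋅ p X Y)) (star (r_adj A D) ⋅ (S ⋅ r X Y)).

(* The constraints of the lax functor with value tensor R S on arrows; the lax
   functor is a pseudofunctor when they are invertible. *)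
Definition tensor_id_constraint (X Y : B) :
    mor (id1 (pobj P X Y : B)) (tensor (id1 X) (id1 Y)) :=
  mpair (L _ _) ((star (p_adj X Y) ◁ lunI (p X Y)) • eta (p_adj X Y))
                ((star (r_adj X Y) ◁ lunI (r X Y)) • eta (r_adj X Y)).

(* (u R' q)(q^* R q') -> u ((R' R) q'), by the counit of q *)
Definition cancel_adjoint (X X' A A' C C' : B) (q : hom A' A)
    (q_adj : right_adjoint q) (u : hom C C') (R' : hom A C) (R : hom X A)
    (q' : hom X' X) :
    mor ((u ⋅ (R' ⋅ q)) ⋅ (star q_adj ⋅ (R ⋅ q'))) (u ⋅ ((R' ⋅ R) ⋅ q')) :=
  (u ◁ (assocI R' R q' • (R' ◁ counit_at (eps q_adj) (R ⋅ q'))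
        • assoc R' q (star q_adj ⋅ (R ⋅ q'))))
  • assoc u (R' ⋅ q) (star q_adj ⋅ (R ⋅ q')).

Definition tensor_cmp_constraint (X Y A D C E : B)
    (R' : hom A C) (S' : hom D E) (R : hom X A) (S : hom Y D) :
    mor (tensor R' S' ⋅ tensor R S) (tensor (R' ⋅ R) (S' ⋅ S)) :=
  mpair (L _ _)
    (cancel_adjoint (p_adj A D) (star (p_adj C E)) R' R (p X Y)
     • hcomp (mfst (L _ _) _ _) (mfst (L _ _) _ _))
    (cancel_adjoint (r_adj A D) (star (r_adj C E)) S' S (r X Y)
     • hcomp (msnd (L _ _) _ _) (msnd (L _ _) _ _)).

Let I : B := tobj P.

Definition unit_arrow : hom I I := top (L I I).

Definition unit_id_constraint : mor (id1 I) unit_arrow := bang (L I I) (id1 I).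

Definition unit_cmp_constraint : mor (unit_arrow ⋅ unit_arrow) unit_arrow :=
  bang (L I I) (unit_arrow ⋅ unit_arrow).

End Tensor.

Record cartesian := Cartesian {
  map_products : finite_products (Map B);
  local_products : forall X A : B, cat_products (hom X A);
  tensor_id_inv : forall X Y : B,
    invertible (tensor_id_constraint map_products local_products X Y);
  tensor_cmp_inv : forall (X Y A D C E : B)
    (R' : hom A C) (S' : hom D E) (R : hom X A) (S : hom Y D),
    invertible (tensor_cmp_constraint map_products local_products R' S' R S);
  unit_id_inv : invertible (unit_id_constraint map_products local_products);
  unit_cmp_inv : invertible (unit_cmp_constraint map_products local_products) }.

Definition separable (C : cartesian) (A : B) : Prop :=
  invertible (eta (radj (pdiag (map_products C) A))).

Definition maps_comonadic : Prop :=
  forall (X A : B) (f : hom X A) (fm : is_map f), comonadic (adj fm).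

End Cartesian.

(* Main.v *)
(* If h : X -> I is a map, then 2-cells T -> h correspond by adjunction to
   2-cells T h^* -> 1_I, and 1_I is terminal in B(I,I) since I is a
   pseudofunctor; so 2-cells into h are unique.  The comonadic map t : A -> I is
   faithful under postcomposition, so, applied to 2-cells T -> f -- with t f again
   a map into I -- this shows that 2-cells into any map f are unique.  For the
   diagonal d it remains to give some 2-cell d^* d -> 1: take
   d^* d ~ p d d^* d -> p d ~ 1.  It is inverse to the unit of d, as 2-cells
   d^* d -> d^* d are transposes of 2-cells into d. *)
From Corelib Require Import ssreflect ssrfun ssrbool.
Require Import Defs.

Set Implicit Arguments.
Unset Strict Implicit.
Unset Printing Implicit Defensive.

Definition subterminal (C : category) (x : C) : Prop :=
  forall z (a b : mor z x), a = b.

Lemma equivalence_faithful (C D : category) (F : functor C D)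
    (e : equivalence F) (x y : C) (a b : mor x y) :
  fmor F a = fmor F b -> a = b.
Proof.
move=> Fab; have [j [jK _]] := nat_inv (eqv_unit e) y.
rewrite -[a]cmp1m -[b]cmp1m -jK -!cmpA; congr (_ • _).
have ca := nat_comm (eqv_unit e) a; have cb := nat_comm (eqv_unit e) b.
by rewrite /= in ca cb; rewrite -ca -cb Fab.
Qed.

Section RightAdjoint.

Variables (B : bicategory) (X A : B) (f : hom X A) (a : right_adjoint f).

Lemma comonadic_faithful (W : B) (h k : hom W X) (b c : mor h k) :
  comonadic a -> f ◁ b = f ◁ c -> b = c.
Proof.
move=> fc fbc; have [e] := fc W.
(* The comparison functor acts on 2-cells as [f ◁ _], and an equivalence is faithful. *)
by apply: (equivalence_faithful e); apply: coalg_mor_eq.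
Qed.

Lemma transpose_inj (W : B) (w : hom W X) (v : hom W A)
    (b c : mor w (star a ⋅ v)) :
  counit_at (eps a) v • (f ◁ b) = counit_at (eps a) v • (f ◁ c) -> b = c.
Proof.
(* By [zag_at], pasting the unit onto the transpose gives [x] back. *)
have tr x : x = (star a ◁ (counit_at (eps a) v • (f ◁ x)))
    • unit_at (eta a) w.
  by rewrite lwhiskM -cmpA -unit_at_nat cmpA zag_at cmp1m.
by move=> bc; rewrite [b]tr [c]tr bc.
Qed.

(** Whiskering the transpose with [f] and pasting on [eta a] recovers the 2-cell, by [zig]. *)
Lemma cotranspose_inj (T : hom X A) (b c : mor T f) :
  eps a • (b ▷ star a) = eps a • (c ▷ star a) -> b = c.
Proof.
have tr x : x • run T = lun f • ((eps a • (x ▷ star a)) ▷ f)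
    • assocI T (star a) f • (T ◁ eta a).
  rewrite -run_nat -(zig a) -!cmpA -interchange /counit_at.
  by strict.
by move=> bc; apply: (cancelr (runIK T)); rewrite !tr bc.
Qed.

Lemma subterminal_map : subterminal (id1 A) -> subterminal f.
Proof. by move=> A1 T b c; apply: cotranspose_inj; apply: A1. Qed.

Lemma subterminal_comonadic (W : B) (k : hom W X) :
  comonadic a -> subterminal (f ⋅ k) -> subterminal k.
Proof. by move=> fc fk T b c; apply: (comonadic_faithful fc); apply: fk. Qed.

Lemma eta_invertible (b : mor (star a ⋅ f) (id1 X)) :
  subterminal (id1 X) -> subterminal f -> invertible (eta a).
Proof.
move=> X1 fT; exists b; split; first exact: X1.
by apply: transpose_inj; apply: fT.
Qed.

End RightAdjoint.

Section Cartesian.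

Variables (B : bicategory) (adj : adjoint_choice B) (C : cartesian adj).

Let P := map_products C.

Lemma subterminal_unit : subterminal (id1 (tobj P : B)).
Proof.
have [j [jK _]] := unit_id_inv C => T b c.
(* The constraint from [id1 I] to the terminal arrow is split monic, so 2-cells may be compared
   after composing with it. *)
apply: (cancell jK).
by rewrite [LHS]bang_uniq [RHS]bang_uniq.
Qed.

Lemma map_subterminal (mc : maps_comonadic adj) (X A : B) (f : hom X A) :
  is_map f -> subterminal f.
Proof.
move=> fm; have [t tm] : @hom (Map B) A (tobj P) := eqv_inv (tobj_eqv P A) tt.
apply: (subterminal_comonadic (mc _ _ t tm)).
have [tf] := is_map_cmp tm fm.
exact: subterminal_map tf subterminal_unit.
Qed.

Lemma pdiag_counit (A : B) :
  inhabited (mor (star (radj adj (pdiag P A)) ⋅ arrow (pdiag P A)) (id1 A)).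
Proof.
set d := arrow _; set a := radj _ _; set p := arrow (prj1 P A A).
pose c := eqv_counit (pobj_eqv P A A A).
pose u : prod_cat (@hom (Map B) A A) (@hom (Map B) A A) := (id1 _, id1 _).
(* The counit at [u] is a pair of invertible 2-cells; its first half and the inverse of that half
   relate [p ⋅ d] to [id1 A]. *)
have i : mor (p ⋅ d) (id1 A) := (c u).1.
have [[j _] _] : invertible (c u) := nat_inv c u.
constructor.
exact: (i • (p ◁ counit_at (eps a) d) • assoc p d (star a ⋅ d)
        • ((j : mor (id1 A) (p ⋅ d)) ▷ (star a ⋅ d)) • lunI (star a ⋅ d)).
Qed.

End Cartesian.

Theorem corollary3p5 (B : bicategory) (B_normal : normal B)
  (adj : adjoint_choice B) (C : cartesian adj) (mc : maps_comonadic adj) :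
  forall A : B, separable C A.
Proof.
move=> A; have [b] := pdiag_counit C A.
apply: (eta_invertible b); apply: (map_subterminal C mc).
- exact: is_map_id.
- exact: proj2_sig.
Qed.
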